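(* Let $V$ be a strictly convex real normed linear space. Then $(V^{(\cdot)}, e)$ is an absolute order unit space; that is, $V^{(\cdot)} = V \times \mathbb{R}$ with the cone $V^{(\cdot)+}$, the absolute value $|\cdot|$ and the order unit norm determined by $e = (0,1)$ (which is $\|(v,\alpha)\| = \|v\| + |\alpha|$) is an absolute order unit space.
   Context: A normed linear space is strictly convex if the line segment joining any two points of its unit sphere does not meet the unit sphere except at its end points. For a real normed linear space $V$: $V^{(\cdot)} := V \times \mathbb{R}$ with coordinatewise operations, $V^{(\cdot)+} := \{(v,\alpha) : \|v\| \le \alpha\}$, ordered by $x \le y$ iff $y - x \in V^{(\cdot)+}$, and $e := (0,1)$. The absolute value $|\cdot| : V^{(\cdot)} \to V^{(\cdot)+}$ is: $|(v,\alpha)| = (v,\alpha)$ if $(v,\alpha) \in V^{(\cdot)+}$; $|(v,\alpha)| = -(v,\alpha)$ if $(v,\alpha) \in -V^{(\cdot)+}$; $|(v,\alpha)| = \left(\frac{\alpha}{\|v\|}v, \|v\|\right)$ otherwise. Absolutely ordered space: a real ordered vector space $(U,U^+)$ with a map $|\cdot| : U \to U^+$ such that (1) $|v| = v$ if $v \in U^+$; (2) $|v| \pm v \in U^+$ for all $v \in U$; (3) $|kv| = |k|\,|v|$ for all $v \in U$, $k \in \mathbb{R}$; (4) if $|u-v| = u+v$ and $|u-w| = u+w$, then $|u - |v \pm w|| = u + |v \pm w|$ (both signs); (5) if $|u-v| = u+v$ and $0 \le w \le v$, then $|u-w| = u+w$. In such a space, $u \perp v$ means $|u-v| = u+v$.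 In a normed ordered linear space $(U,U^+,\|\cdot\|)$: $x \perp_\infty y$ means $\|x + ky\| = \max(\|x\|, \|ky\|)$ for all $k \in \mathbb{R}$; for $u,v \in U^+$, $u \perp_\infty^a v$ (absolutely $\infty$-orthogonal) means that $u_1 \perp_\infty v_1$ whenever $0 \le u_1 \le u$ and $0 \le v_1 \le v$. An absolute order smooth $\infty$-normed space is an absolutely ordered space $(U,U^+,|\cdot|)$ with a norm $\|\cdot\|$ on $U$ such that $(O.\infty.1)$ if $u \le v \le w$ in $U$, then $\|v\| \le \max(\|u\|,\|w\|)$; $(O.\perp_\infty.1)$ if $u,v \in U^+$ with $u \perp v$, then $u \perp_\infty^a v$; $(O.\perp_\infty.2)$ if $u,v \in U^+$ with $u \perp_\infty^a v$, then $u \perp v$. An absolute order unit space is an absolute order smooth $\infty$-normed space possessing an order unit $e \in U^+$ which determines $\|\cdot\|$ as an order unit norm, i.e. $\|x\| = \inf\{k > 0 : -ke \le x \le ke\}$ for all $x \in U$. *)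

(* Defs.v *)
From HB Require Import structures.
From mathcomp Require Import all_boot all_order all_algebra.
From mathcomp Require Import all_classical all_reals all_analysis.

Set Implicit Arguments.
Unset Strict Implicit.
Unset Printing Implicit Defensive.

Import Order.TTheory GRing.Theory Num.Theory.
Import numFieldNormedType.Exports.

Local Open Scope classical_set_scope.
Local Open Scope ring_scope.

Definition strictly_convex (R : realType) (V : normedModType R) : Prop :=
  forall (x y : V) (t : R), `|x| = 1 -> `|y| = 1 -> 0 <= t <= 1 ->
    `|(1 - t) *: x + t *: y| = 1 ->
    (1 - t) *: x + t *: y = x \/ (1 - t) *: x + t *: y = y.

(* The positive cone [C], the absolute value [abs] and the norm [N] are passed
   explicitly, over a bare real vector space [U]: the norm that the library
   already puts on a product is the maximum norm, which is not the order unit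
   norm considered here. *)
Section AbsoluteOrderUnitSpaces.
Context (R : realType) (U : lmodType R).
Implicit Types (C : set U) (abs : U -> U) (N : U -> R) (e x y u v w : U).

Definition cone_le C x y : Prop := C (y - x).

Record real_ordered_vector_space C : Prop := {
  cone0 : C 0;
  coneD : forall x y, C x -> C y -> C (x + y);
  coneZ : forall (k : R) x, 0 <= k -> C x -> C (k *: x);
  cone_proper : forall x, C x -> C (- x) -> x = 0
}.

Definition abs_orth abs u v : Prop := abs (u - v) = u + v.

Record absolutely_ordered_space C abs : Prop := {
  aos_ordered : real_ordered_vector_space C;
  aos_abs_pos : forall v, C (abs v);
  aos_abs_id : forall v, C v -> abs v = v;
  aos_absD_pos : forall v, C (abs v + v);
  aos_absB_pos : forall v, C (abs v - v);
  aos_absZ : forall v (k : R), abs (k *: v) = `|k| *: abs v;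
  aos_orthD : forall u v w, abs_orth abs u v -> abs_orth abs u w ->
    abs_orth abs u (abs (v + w));
  aos_orthB : forall u v w, abs_orth abs u v -> abs_orth abs u w ->
    abs_orth abs u (abs (v - w));
  aos_orth_le : forall u v w, abs_orth abs u v ->
    cone_le C 0 w -> cone_le C w v -> abs_orth abs u w
}.

Record vector_norm N : Prop := {
  vnorm_ge0 : forall x, 0 <= N x;
  vnorm_eq0 : forall x, N x = 0 -> x = 0;
  vnormZ : forall (k : R) x, N (k *: x) = `|k| * N x;
  vnormD : forall x y, N (x + y) <= N x + N y
}.

Definition infty_orth N x y : Prop :=
  forall k : R, N (x + k *: y) = Num.max (N x) (N (k *: y)).

Definition abs_infty_orth C N u v : Prop :=
  forall u1 v1, cone_le C 0 u1 -> cone_le C u1 u ->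
    cone_le C 0 v1 -> cone_le C v1 v -> infty_orth N u1 v1.

Record absolute_order_smooth_infty_normed_space C abs N : Prop := {
  aosn_aos : absolutely_ordered_space C abs;
  aosn_norm : vector_norm N;
  aosn_Oinfty1 : forall u v w, cone_le C u v -> cone_le C v w ->
    N v <= Num.max (N u) (N w);
  aosn_Operp1 : forall u v, C u -> C v ->
    abs_orth abs u v -> abs_infty_orth C N u v;
  aosn_Operp2 : forall u v, C u -> C v ->
    abs_infty_orth C N u v -> abs_orth abs u v
}.

Definition order_unit C e : Prop :=
  C e /\ forall x, exists2 k : R, 0 < k &
    cone_le C (- (k *: e)) x /\ cone_le C x (k *: e).

Definition order_unit_norm C e x : R :=
  inf [set k : R | [/\ 0 < k, cone_le C (- (k *: e)) x & cone_le C x (k *: e)]].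

Record absolute_order_unit_space C abs N e : Prop := {
  aous_aosn : absolute_order_smooth_infty_normed_space C abs N;
  aous_unit : order_unit C e;
  aous_normE : forall x, N x = order_unit_norm C e x
}.

End AbsoluteOrderUnitSpaces.

(* [R^o] is [R] viewed as a vector space over itself. *)
Section Dot.
Context (R : realType) (V : normedModType R).

Definition dot : lmodType R := (V * R^o)%type.

Definition dot_cone : set dot := [set x | `|x.1| <= x.2 :> R].

Definition dot_abs (x : dot) : dot :=
  if x \in dot_cone then x
  else if - x \in dot_cone then - x
  else ((x.2 / `|x.1|) *: x.1, `|x.1|).

Definition dot_unit : dot := (0, 1).

End Dot.

Arguments dot_cone {R} V.
Arguments dot_abs {R} V x.
Arguments dot_unit {R} V.

(* Main.v *)
Require Import Defs.
From mathcomp Require Import all_boot all_order all_algebra.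
From mathcomp Require Import all_classical all_reals all_analysis.
From mathcomp Require Import ring lra.
Import Order.TTheory GRing.Theory Num.Theory.
Import numFieldNormedType.Exports.
Local Open Scope ring_scope.

(** Everything rests on an explicit description of orthogonality in [dot V].
    If [|u - v| = u + v], then [u] and [v] are positive, because the absolute
    value dominates both signs.  When [u - v] or [v - u] is positive, one of
    [u], [v] vanishes.  Otherwise the second coordinates give
    [`|u.1 - v.1| = u.2 + v.2], which forces [u] and [v] to lie on the boundary
    of the cone, and the first coordinates then give
    [v = b *: (- u.1, u.2)] for some [b >= 0].  Conversely all such pairs are
    orthogonal.  So the orthogonal complement of a nonzero boundary vector [u] is
    the single ray opposite to it in the cone, and that of a nonzero interior
    vector is zero ([dot_orthP], [dot_orth_refl]).

    Since the complement of [u != 0] spans at most a line, stability of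
    orthogonality under absolute values of sums and differences reduces to the
    homogeneity of the absolute value ([dot_orth_abs_comb]).  Stability under
    [0 <= w <= v] says that the boundary ray of [v] is a face of the cone, and
    this is where strict convexity enters: [0 <= w <= v] turns the triangle
    inequality for [w.1 + (v.1 - w.1)] into an equality, so the two summands
    are positively proportional ([strictly_convex_colinear],
    [dot_orth_le]).

    The order unit norm is [`|x.1| + `|x.2|] because [- k e <= x <= k e] means
    [`|x.1| + `|x.2| <= k].  For opposite boundary vectors the identity
    [`|1 - c| + `|1 + c| = 2 max(1, `|c|)] yields infinity-orthogonality
    ([dot_orth_infty]).  Conversely, testing infinity-orthogonality of positive
    [u], [v] at the single [k] that equalizes the norms of [u] and [k v] forces
    [u.1 + k v.1 = 0] and puts both vectors on the boundary
    ([dot_infty_orth]). *)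

(** * The cone and the absolute value *)

Lemma dotP {R : realType} {V : normedModType R} (x y : dot V) :
  x.1 = y.1 -> x.2 = y.2 -> x = y.
Proof. by case: x y => [? ?] [? ?] /= -> ->. Qed.

Lemma dot_cone_ordered {R : realType} (V : normedModType R) :
  real_ordered_vector_space (dot_cone V).
Proof.
rewrite /dot_cone; split => /=.
- by rewrite normr0.
- by move=> x y hx hy; apply: le_trans (ler_normD _ _) (lerD hx hy).
- move=> k x k0 hx; rewrite normrZ (ger0_norm k0).
  exact: (ler_wpM2l k0).
- move=> x hx; rewrite normrN => hNx.
  have h0 := normr_ge0 x.1; apply: dotP; last by move: hx hNx h0 => /=; lra.
  by apply/normr0_eq0; move: hx hNx h0 => /=; lra.
Qed.

Lemma dot_abs_pos {R : realType} {V : normedModType R} (x : dot V) :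
  dot_cone V x -> dot_abs V x = x.
Proof. by move=> hx; rewrite /dot_abs mem_set. Qed.

Lemma dot_abs_neg {R : realType} {V : normedModType R} (x : dot V) :
  dot_cone V (- x) -> dot_abs V x = - x.
Proof.
move=> hx; rewrite /dot_abs; case: ifPn => [/set_mem hx'|_].
  rewrite (cone_proper (dot_cone_ordered V) hx' hx).
  by rewrite oppr0.
by rewrite mem_set.
Qed.

(** The third formula of the absolute value is valid up to the boundary, where
    it agrees with the first two.  Hence later computations with boundary
    vectors need no case distinction. *)
Lemma dot_abs_mid {R : realType} {V : normedModType R} (x : dot V) :
  `|x.2 : R| <= `|x.1| -> dot_abs V x = ((x.2 / `|x.1|) *: x.1, `|x.1|).
Proof.
rewrite ler_norml => /andP[hl hr].
have [x0|x0] := eqVneq x.1 0.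
  move: hl hr; rewrite x0 normr0 => hl hr.
  have -> : x = 0 by apply: dotP => //=; lra.
  by rewrite dot_abs_pos /dot_cone /= ?normr0 // scaler0.
have n0 : `|x.1| != 0 by rewrite normr_eq0.
rewrite /dot_abs; case: ifPn => [/set_mem|_].
  rewrite /dot_cone /= => h; have e : x.2 = `|x.1| by lra.
  by apply: dotP; rewrite //= e divff // scale1r.
case: ifPn => [/set_mem|//].
rewrite /dot_cone /= normrN => h; have e : x.2 = - `|x.1| by lra.
by apply: dotP; rewrite /= e ?opprK // mulNr divff // scaleN1r.
Qed.

Variant dot_abs_spec {R : realType} {V : normedModType R} (x : dot V) :
    dot V -> Prop :=
  | DotAbsPos of dot_cone V x : dot_abs_spec x x
  | DotAbsNeg of dot_cone V (- x) : dot_abs_spec x (- x)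
  | DotAbsMid of `|x.2 : R| < `|x.1| :
      dot_abs_spec x ((x.2 / `|x.1|) *: x.1, `|x.1|).

Lemma dot_absP {R : realType} {V : normedModType R} (x : dot V) :
  dot_abs_spec x (dot_abs V x).
Proof.
have [h|h] := lerP `|x.1| x.2.
  by rewrite dot_abs_pos; [constructor|].
have [h'|h'] := lerP `|x.1| (- x.2).
  have hN : dot_cone V (- x) by rewrite /dot_cone /= normrN.
  by rewrite dot_abs_neg; [constructor|].
have hm : `|x.2 : R| < `|x.1| by rewrite ltr_norml; apply/andP; split; lra.
by rewrite dot_abs_mid ?ltW //; constructor.
Qed.

Lemma dot_absN {R : realType} {V : normedModType R} (x : dot V) :
  dot_abs V (- x) = dot_abs V x.
Proof.
case: (dot_absP x) => h.
- by rewrite dot_abs_neg opprK.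
- by rewrite dot_abs_pos.
- rewrite dot_abs_mid /= ?normrN ?ltW //; apply: dotP => //=.
  by rewrite scalerN mulNr scaleNr opprK.
Qed.

Lemma dot_absZ {R : realType} {V : normedModType R} (x : dot V) (k : R) :
  dot_abs V (k *: x) = `|k| *: dot_abs V x.
Proof.
(* The absolute value is even, so the sign of [k] can be absorbed. *)
wlog k0 : k / 0 <= k => [hw|].
  have [/hw //|/ltW k0] := lerP 0 k.
  by rewrite -dot_absN -scaleNr -normrN hw // oppr_ge0.
have CZ := coneZ (dot_cone_ordered V).
rewrite (ger0_norm k0); case: (dot_absP x) => h.
- by rewrite dot_abs_pos //; apply: CZ.
- by rewrite dot_abs_neg -scalerN //; apply: CZ.
have mulk (a b : R) : `|a| <= b -> `|k * a| <= k * b.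
  by move=> hab; rewrite normrM (ger0_norm k0) ler_wpM2l.
have hk : `|(k *: x).2 : R| <= `|(k *: x).1|.
  rewrite [leRHS]normrZ (ger0_norm k0); apply: mulk; exact: ltW.
rewrite dot_abs_mid //.
have n0 : `|x.1| != 0 by rewrite gt_eqF // (le_lt_trans _ h).
have [->|kn0] := eqVneq k 0.
  by apply: dotP; rewrite /= ?scale0r ?normr0 ?scaler0.
apply: dotP; rewrite /= normrZ (ger0_norm k0) //.
rewrite !scalerA; congr (_ *: _); rewrite /GRing.scale /=.
by field; rewrite n0 kn0.
Qed.

Lemma dot_absD_pos {R : realType} {V : normedModType R} (x : dot V) :
  dot_cone V (dot_abs V x + x).
Proof.
have [C0 CD _ _] := dot_cone_ordered V.
case: (dot_absP x) => h; [exact: CD | by rewrite addNr|].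
have n0 : 0 < `|x.1| by exact: le_lt_trans h.
rewrite /dot_cone /= -[X in `|_ + X|]scale1r -scalerDl [leLHS]normrZ.
move: h; rewrite ltr_norml => /andP[hl hr].
rewrite -{2}(gtr0_norm n0) -normrM mulrDl mul1r divfK ?gt_eqF // ger0_norm; lra.
Qed.

Lemma dot_abs_ge0 {R : realType} {V : normedModType R} (x : dot V) :
  dot_cone V (dot_abs V x).
Proof.
case: (dot_absP x) => // h.
have n0 : 0 < `|x.1| by exact: le_lt_trans h.
by rewrite /dot_cone /= normrZ -{2}(gtr0_norm n0) -normrM divfK ?gt_eqF // ltW.
Qed.

(** * Orthogonality in the cone *)

Lemma dot_orth_sym {R : realType} {V : normedModType R} {u v : dot V} :
  abs_orth (dot_abs V) u v -> abs_orth (dot_abs V) v u.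
Proof. by move=> huv; rewrite /abs_orth -opprB dot_absN huv addrC. Qed.

(** The positive vector [|u - v| + (u - v)] is [2 u] when [u] and [v] are
    orthogonal, so orthogonality carries its own positivity. *)
Lemma dot_orth_pos {R : realType} {V : normedModType R} {u v : dot V} :
  abs_orth (dot_abs V) u v -> dot_cone V u.
Proof.
move=> h; have := dot_absD_pos (u - v); rewrite h addrACA subrr addr0 => h2.
have -> : u = 2^-1 *: (u + u).
  rewrite -[u + u]mulr2n -[u *+ 2]scaler_nat.
  by rewrite scalerA mulVf ?scale1r ?pnatr_eq0.
by apply: (coneZ (dot_cone_ordered V)); rewrite // invr_ge0.
Qed.

(** For a nonzero [u] on the boundary of the cone this spans the boundary ray
    antipodal to that of [u]. *)
Definition dot_refl {R : realType} {V : normedModType R} (x : dot V) : dot V :=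
  (- x.1, x.2).

Lemma dot_orth0l {R : realType} {V : normedModType R} (v : dot V) :
  dot_cone V v -> abs_orth (dot_abs V) 0 v.
Proof. by move=> Cv; rewrite /abs_orth sub0r add0r dot_absN dot_abs_pos. Qed.

Lemma dot_orth0r {R : realType} {V : normedModType R} (v : dot V) :
  dot_cone V v -> abs_orth (dot_abs V) v 0.
Proof. by move=> /dot_orth0l/dot_orth_sym. Qed.

(** The second coordinate of [u - b *: dot_refl u] is [(1 - b) u.2] and its
    first one has norm [(1 + b) u.2], so the third formula of the absolute
    value applies and turns the factors [1 + b], [1 - b] into
    [1 - b], [1 + b], which is [u + b *: dot_refl u]. *)
Lemma dot_orth_refl {R : realType} {V : normedModType R} (u : dot V) (b : R) :
  `|u.1| = u.2 -> 0 <= b -> abs_orth (dot_abs V) u (b *: dot_refl u).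
Proof.
move=> hu b0; have Cu : dot_cone V u by rewrite /dot_cone /= hu.
have [u1|u1] := eqVneq u.1 0.
  have u0 : u = 0 by apply: dotP => //=; rewrite -hu u1 normr0.
  rewrite u0 /dot_refl oppr0 -[(0, 0)]/(0 : dot V) scaler0.
  by apply: dot_orth0l; rewrite -u0.
have n0 : `|u.1| != 0 by rewrite normr_eq0.
have e1 : (u - b *: dot_refl u).1 = (1 + b) *: u.1.
  by rewrite /= scalerN opprK scalerDl scale1r.
have e2 : (u - b *: dot_refl u).2 = (1 - b) * `|u.1|.
  by rewrite hu mulrBl mul1r.
have e : `|(u - b *: dot_refl u).1| = (1 + b) * `|u.1|.
  by rewrite e1 normrZ ger0_norm //; lra.
have b1 : 1 + b != 0 by rewrite gt_eqF //; lra.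
rewrite /abs_orth dot_abs_mid; rewrite e e2 ?e1; last first.
  by rewrite normrM normr_id ler_wpM2r // ler_norml; apply/andP; split; lra.
apply: dotP => /=; last by rewrite -hu mulrDl mul1r.
rewrite scalerA scalerN -scaleNr -[X in _ = X + _]scale1r -scalerDl.
congr (_ *: _); by field; rewrite n0 b1.
Qed.

(** The last constructor excludes [u.1 = 0], that is [u = 0] in this case, so
    that [u.2] is invertible there. *)
Variant dot_orth_spec {R : realType} {V : normedModType R} (u : dot V) :
    dot V -> Prop :=
  | DotOrth0l v of u = 0 & dot_cone V v : dot_orth_spec u v
  | DotOrth0r of dot_cone V u : dot_orth_spec u 0
  | DotOrthRefl b of u.1 != 0 & `|u.1| = u.2 & 0 <= b :
      dot_orth_spec u (b *: dot_refl u).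

(** In the generic case the second coordinates say
    [`|u.1 - v.1| = u.2 + v.2]; with [`|u.1| <= u.2] and [`|v.1| <= v.2] the
    triangle inequality is an equality and both vectors are on the boundary.
    The first coordinates are then a linear equation for [v.1] in terms of
    [u.1]. *)
Lemma dot_orthP {R : realType} {V : normedModType R} {u v : dot V} :
  abs_orth (dot_abs V) u v -> dot_orth_spec u v.
Proof.
move=> huv; have Cu := dot_orth_pos huv.
have Cv := dot_orth_pos (dot_orth_sym huv).
have two (x : dot V) : - x = x -> x = 0.
  move=> /eqP; rewrite eq_sym -addr_eq0 -mulr2n -scaler_nat scaler_eq0.
  by rewrite pnatr_eq0 => /eqP.
move: huv; rewrite /abs_orth; case: (dot_absP (u - v)) => h e.
- have -> : v = 0 by apply: two; apply: (addrI u).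
  exact: DotOrth0r.
- apply: DotOrth0l => //; apply: two; apply: (addIr v).
  by rewrite -e opprB addrC.
- have /= e1 := congr1 fst e; have /= e2 := congr1 snd e.
  move: Cu Cv (ler_normB u.1 v.1) h e1; rewrite /dot_cone /= => Cu Cv hle h e1.
  have hu : `|u.1| = u.2 by lra.
  have hv : `|v.1| = v.2 by lra.
  have [u1|u1] := eqVneq u.1 0.
    by apply: DotOrth0l => //; apply: dotP => //=; rewrite -hu u1 normr0.
  have n0 : 0 < u.2 by rewrite -hu normr_gt0.
  have v0 : 0 <= v.2 by rewrite -hv.
  have s0 : u.2 + v.2 != 0 by rewrite gt_eqF //; lra.
  suff -> : v = (v.2 / u.2) *: dot_refl u.
    by apply: DotOrthRefl => //; rewrite divr_ge0 // ltW.
  apply: dotP => /=; last by rewrite /GRing.scale /= divfK // gt_eqF.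
  move: e1; rewrite e2; set s := (u.2 - v.2) / _ => e1.
  (* [e1] now reads [s *: (u.1 - v.1) = u.1 + v.1]; it is solved for [v.1]. *)
  have e3 : (1 + s) *: v.1 = (s - 1) *: u.1.
    move/eqP: e1; rewrite scalerBr subr_eq => /eqP e1.
    by rewrite scalerDl scalerBl !scale1r e1 [RHS]addrC -addrA addKr.
  have s1 : 1 + s = 2 * u.2 / (u.2 + v.2) by rewrite /s; field.
  have s1n : 1 + s != 0.
    by rewrite s1 !mulf_neq0 ?invr_eq0 // gt_eqF.
  rewrite -[v.1](scalerK s1n) e3 scalerA scalerN -scaleNr; congr (_ *: _).
  by rewrite s1 /s; field; rewrite s0 gt_eqF.
Qed.

(** * Strict convexity and the absolutely ordered space *)

(** The normalization of [p + q] is the convex combination of the normalized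
    [p] and [q] with weights proportional to [`|p|] and [`|q|].  Equality in
    the triangle inequality puts it on the unit sphere, so by strict convexity
    it is an end point; as both weights are nonzero, the two ends coincide. *)
Lemma strictly_convex_colinear {R : realType} {V : normedModType R} (p q : V) :
  strictly_convex V -> `|p + q| = `|p| + `|q| -> `|q| *: p = `|p| *: q.
Proof.
move=> hV hpq.
have [->|p0] := eqVneq p 0; first by rewrite normr0 scaler0 scale0r.
have [->|q0] := eqVneq q 0; first by rewrite normr0 scaler0 scale0r.
have P : 0 < `|p| by rewrite normr_gt0.
have Q : 0 < `|q| by rewrite normr_gt0.
have Pn : `|p| != 0 by rewrite gt_eqF.
have Qn : `|q| != 0 by rewrite gt_eqF.
have Sn : `|p| + `|q| != 0 by rewrite gt_eqF // addr_gt0.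
set t := `|q| / (`|p| + `|q|).
have ht : 1 - t = `|p| / (`|p| + `|q|) by rewrite /t; field.
have t0 : t != 0 by rewrite /t mulf_neq0 // invr_eq0.
have t1 : 1 - t != 0 by rewrite ht mulf_neq0 // invr_eq0.
have nunit (z : V) : `|z| != 0 -> `|(`|z|)^-1 *: z| = 1.
  by move=> z0; rewrite normrZ normfV normr_id mulVf.
have e : (1 - t) *: (`|p|^-1 *: p) + t *: (`|q|^-1 *: q) =
    (`|p| + `|q|)^-1 *: (p + q).
  rewrite !scalerA ht scalerDr /t; congr (_ *: _ + _ *: _); field;
  by rewrite ?Sn ?Pn ?Qn.
suff E : `|p|^-1 *: p = `|q|^-1 *: q.
  have := congr1 (fun z => (`|p| * `|q|) *: z) E.
  by rewrite /= !scalerA mulrAC mulfV // mul1r -mulrA mulfV // mulr1.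
have := hV (`|p|^-1 *: p) (`|q|^-1 *: q) t (nunit _ Pn) (nunit _ Qn).
case.
- by rewrite /t divr_ge0 ?addr_ge0 //= ler_pdivrMr ?addr_gt0 // mul1r lerDr.
- by rewrite e -hpq nunit // hpq.
- move=> h; symmetry; apply: (scalerI t0).
  apply: (addrI ((1 - t) *: (`|p|^-1 *: p))).
  by rewrite h -scalerDl subrK scale1r.
- move=> h; apply: (scalerI t1); apply: (addIr (t *: (`|q|^-1 *: q))).
  by rewrite h -scalerDl subrK scale1r.
Qed.

(** For [v = b *: dot_refl u] on the boundary, [w] and [v - w] in the cone give
    [`|v.1| <= `|w.1| + `|v.1 - w.1| <= w.2 + (v.2 - w.2) = `|v.1|].  Hence [w]
    is on the boundary too, and strict convexity makes [w.1] a nonnegative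
    multiple of [v.1]: [w] stays on the ray of [v]. *)
Lemma dot_orth_le {R : realType} {V : normedModType R} {u v w : dot V} :
  strictly_convex V -> abs_orth (dot_abs V) u v ->
  cone_le (dot_cone V) 0 w -> cone_le (dot_cone V) w v ->
  abs_orth (dot_abs V) u w.
Proof.
rewrite /cone_le subr0 => hV huv Cw Cvw.
have v0 : v = 0 -> abs_orth (dot_abs V) u w.
  move=> v0; move: Cvw; rewrite v0 sub0r => CNw.
  rewrite (cone_proper (dot_cone_ordered V) Cw CNw); apply: dot_orth0r.
  exact: dot_orth_pos huv.
case: (dot_orthP huv) Cvw v0 =>
  [{huv}v u0 _ _ _|_ _ /(_ erefl)//|b u1 hu b0 Cvw v0].
  by rewrite u0; apply: dot_orth0l.
have [b00|bn0] := eqVneq b 0; first by apply: v0; rewrite b00 scale0r.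
have un0 : u.2 != 0 by rewrite -hu normr_eq0.
pose q := (b *: dot_refl u - w).1.
have vE : w.1 + q = (b *: dot_refl u).1 by rewrite /q /= addrC subrK.
have nv : `|w.1 + q| = b * u.2 by rewrite vE /= normrZ normrN hu ger0_norm.
have hq : `|q| <= b * u.2 - w.2 by exact: Cvw.
have hw : `|w.1| <= w.2 by exact: Cw.
have htri := ler_normD w.1 q.
have nw : `|w.1| = w.2 by lra.
have nq : `|q| = b * u.2 - w.2 by lra.
have := @strictly_convex_colinear _ _ w.1 q hV; rewrite nv nw nq.
move=> /(_ ltac:(by rewrite addrC subrK)).
rewrite scalerBl => /eqP; rewrite subr_eq -scalerDr addrC vE /= => /eqP E.
have w20 : 0 <= w.2 by rewrite -nw.
suff -> : w = (w.2 / u.2) *: dot_refl u.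
  by apply: dot_orth_refl => //; rewrite divr_ge0 // -hu.
apply: dotP => /=; last by rewrite /GRing.scale /= divfK.
apply: (scalerI (mulf_neq0 bn0 un0)); rewrite E !scalerA; congr (_ *: _).
by field.
Qed.

(** The multiples of [dot_refl u] form a line on which the absolute value is
    [|c *: dot_refl u| = `|c| *: dot_refl u].  The sum and difference axioms are
    the instances [s = 1] and [s = -1]. *)
Lemma dot_orth_abs_comb {R : realType} {V : normedModType R} {u v w : dot V}
    (s : R) :
  abs_orth (dot_abs V) u v -> abs_orth (dot_abs V) u w ->
  abs_orth (dot_abs V) u (dot_abs V (v + s *: w)).
Proof.
move=> huv huw; have Cu := dot_orth_pos huv.
have [hu|hu] := eqVneq `|u.1| u.2; last first.
  (* Off the boundary only [0] is orthogonal to a nonzero [u]. *)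
  have z x : abs_orth (dot_abs V) u x -> u = 0 \/ x = 0.
    by case/dot_orthP => [|_|? _ /eqP]; [left|right|rewrite (negPf hu)].
  have [->|v0] := z _ huv; first by apply: dot_orth0l; exact: dot_abs_ge0.
  have [->|w0] := z _ huw; first by apply: dot_orth0l; exact: dot_abs_ge0.
  rewrite v0 w0 scaler0 addr0 dot_abs_pos; first exact: dot_orth0r.
  exact: (cone0 (dot_cone_ordered V)).
have z x : abs_orth (dot_abs V) u x -> u = 0 \/ exists b, x = b *: dot_refl u.
  case/dot_orthP => [|_|b _ _ _]; [by left| |by right; exists b].
  by right; exists 0; rewrite scale0r.
have [->|[b ->]] := z _ huv; first by apply: dot_orth0l; exact: dot_abs_ge0.
have [->|[c ->]] := z _ huw; first by apply: dot_orth0l; exact: dot_abs_ge0.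
rewrite scalerA -scalerDl dot_absZ dot_abs_pos; first exact: dot_orth_refl.
by rewrite /dot_cone /= normrN hu.
Qed.

Lemma dot_absolutely_ordered {R : realType} {V : normedModType R} :
  strictly_convex V -> absolutely_ordered_space (dot_cone V) (dot_abs V).
Proof.
move=> hV; split.
- exact: dot_cone_ordered.
- exact: dot_abs_ge0.
- exact: dot_abs_pos.
- exact: dot_absD_pos.
- by move=> v; rewrite -dot_absN; exact: dot_absD_pos.
- by move=> v k; exact: dot_absZ.
- by move=> u v w huv huw; rewrite -[w]scale1r; exact: dot_orth_abs_comb.
- by move=> u v w huv huw; rewrite -[- w]scaleN1r; exact: dot_orth_abs_comb.
- by move=> u v w; exact: dot_orth_le.
Qed.

(** * The order unit norm *)

Definition dot_norm {R : realType} {V : normedModType R} (x : dot V) : R :=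
  `|x.1| + `|x.2 : R|.

Lemma dot_unit_intervalP {R : realType} {V : normedModType R} (x : dot V)
    (k : R) :
  cone_le (dot_cone V) (- (k *: dot_unit V)) x /\
  cone_le (dot_cone V) x (k *: dot_unit V) <-> dot_norm x <= k.
Proof.
have h (a n : R) : n <= a + k /\ n <= k - a <-> n + `|a| <= k.
  by case: (ger0P a) => ?; split => [[? ?]|?]; [|split| |split]; lra.
rewrite -h /cone_le /dot_cone /= !scaler0 !oppr0 addr0 sub0r normrN.
by rewrite /GRing.scale /= mulr1 opprK.
Qed.

Lemma dot_vector_norm {R : realType} {V : normedModType R} :
  vector_norm (@dot_norm R V).
Proof.
rewrite /dot_norm; split.
- by move=> x; rewrite addr_ge0.
- move=> x; move: (normr_ge0 x.1) (normr_ge0 (x.2 : R)) => h1 h2 e.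
  by apply: dotP => /=; apply/normr0_eq0; lra.
- by move=> k x; rewrite normrZ (normrM k (x.2 : R)) mulrDr.
- by move=> x y; rewrite addrACA lerD // ler_normD.
Qed.

(** The infimum defining the order unit norm ranges over positive [k] only, so
    it need not be attained at [x = 0]; for that reason it is bounded above
    through [dot_norm x + e] with [e > 0]. *)
Lemma dot_order_unit_normE {R : realType} {V : normedModType R} (x : dot V) :
  order_unit_norm (dot_cone V) (dot_unit V) x = dot_norm x.
Proof.
have N0 := vnorm_ge0 dot_vector_norm x.
rewrite /order_unit_norm; set A := (X in inf X).
have AE k : A k <-> 0 < k /\ dot_norm x <= k.
  by rewrite -dot_unit_intervalP; split => [[]|[? []]].
have lbA : lbound A (dot_norm x) by move=> k /AE[].
have A1 (e : R) : 0 < e -> A (dot_norm x + e) by move=> e0; apply/AE; lra.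
apply/eqP; rewrite eq_le; apply/andP; split; last first.
  by apply: lb_le_inf => //; exists (dot_norm x + 1); exact: A1.
apply/ler_addgt0Pr => e e0; apply: ge_inf; last exact: A1.
by exists (dot_norm x).
Qed.

Lemma dot_norm_cone {R : realType} {V : normedModType R} (x : dot V) :
  dot_cone V x -> dot_norm x = `|x.1| + x.2.
Proof.
rewrite /dot_norm /dot_cone /= => h.
by rewrite (@ger0_norm R) // (le_trans _ h).
Qed.

Lemma dot_norm_interval {R : realType} {V : normedModType R} (u v w : dot V) :
  cone_le (dot_cone V) u v -> cone_le (dot_cone V) v w ->
  dot_norm v <= Num.max (dot_norm u) (dot_norm w).
Proof.
move=> huv hvw; set m := Num.max _ _.
have hu : dot_norm u <= m by rewrite le_max lexx.
have hw : dot_norm w <= m by rewrite le_max lexx orbT.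
have tr (x y z : dot V) : cone_le (dot_cone V) x y ->
    cone_le (dot_cone V) y z -> cone_le (dot_cone V) x z.
  rewrite /cone_le => hxy hyz; rewrite -(subrK y z) -addrA.
  exact: (coneD (dot_cone_ordered V)).
apply/dot_unit_intervalP; split.
  by case/dot_unit_intervalP: hu => + _; move/tr; apply.
by case/dot_unit_intervalP: hw => _; apply: tr.
Qed.

(** * Orthogonality and infinity-orthogonality *)

(** For a pair [u], [c *: dot_refl u] the claim, divided by [u.2], is
    [`|1 - c| + `|1 + c| = max(2, 2 `|c|)]. *)
Lemma dot_orth_infty {R : realType} {V : normedModType R} {u v : dot V} :
  abs_orth (dot_abs V) u v -> infty_orth dot_norm u v.
Proof.
have [N0 _ NZ _] := @dot_vector_norm R V.
have NN0 : dot_norm (0 : dot V) = 0 by rewrite /dot_norm !normr0 addr0.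
case/dot_orthP => [{}v -> _|_|b u1 hu b0] k.
- by rewrite add0r NN0; rewrite max_r.
- by rewrite scaler0 addr0 NN0 max_l.
have {}u1 : 0 < u.2 by rewrite -hu normr_gt0.
set c := k * b.
have -> : k *: (b *: dot_refl u) = c *: dot_refl u by rewrite scalerA.
rewrite NZ {1 2 3}/dot_norm /= normrN hu.
have -> : u.1 + c *: (- u.1) = (1 - c) *: u.1.
  by rewrite scalerN scalerBl scale1r.
have -> : u.2 + c *: u.2 = (1 + c) * u.2 by rewrite mulrDl mul1r.
rewrite normrZ (@normrM R) hu (gtr0_norm u1).
have -> : `|c| * (u.2 + u.2) = (2 * `|c|) * u.2 by ring.
have -> : u.2 + u.2 = 2 * u.2 by ring.
rewrite -mulrDl -maxr_pMl ?ltW //; congr (_ * _).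
by case: (lerP 2 (2 * `|c|)); case: (ger0P c) => ? ?;
  case: (ger0P (1 - c)); case: (ger0P (1 + c)); lra.
Qed.

(** Let [k] equalize the norms and [y = k *: v].  Infinity-orthogonality gives
    [`|u.1 + y.1| + u.2 + y.2 = `|u.1| + u.2 = `|y.1| + y.2].  Since
    [`|u.1| <= u.2] and [`|y.1| <= y.2], adding the two equations leaves
    [2 `|u.1 + y.1| <= 0], hence [y.1 = - u.1] and both vectors are on the
    boundary. *)
Lemma dot_infty_orth {R : realType} {V : normedModType R} {u v : dot V} :
  dot_cone V u -> dot_cone V v -> infty_orth dot_norm u v ->
  abs_orth (dot_abs V) u v.
Proof.
move=> Cu Cv huv; have [N0 Neq0 NZ _] := @dot_vector_norm R V.
have [->|u0] := eqVneq u 0; first exact: dot_orth0l.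
have [->|v0] := eqVneq v 0; first exact: dot_orth0r.
have Npos (x : dot V) : x != 0 -> 0 < dot_norm x.
  by move=> x0; rewrite lt_def N0 andbT; apply: contra_neq x0; exact: Neq0.
have {}u0 := Npos _ u0; have {}v0 := Npos _ v0.
pose k := dot_norm u / dot_norm v.
have k0 : 0 < k by rewrite divr_gt0.
have Ckv := coneZ (dot_cone_ordered V) (ltW k0) Cv.
have Nkv : dot_norm (k *: v) = dot_norm u.
  by rewrite NZ gtr0_norm // divfK // gt_eqF.
have := huv k; rewrite Nkv maxxx.
move: (Nkv); rewrite !dot_norm_cone //; last first.
  exact: (coneD (dot_cone_ordered V)).
set y := k *: v; move: (Cu) (Ckv); rewrite /dot_cone /= => hu hy e1 e2.
have h0 := normr_ge0 (u.1 + y.1).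
have z : u.1 + y.1 = 0 by apply/normr0_eq0; move: hu hy e1 e2 => /=; lra.
move: e1 e2 hu hy; rewrite z normr0 /= => e1 e2 hu hy.
have hu2 : `|u.1| = u.2 by lra.
suff -> : v = k^-1 *: dot_refl u.
  by apply: dot_orth_refl => //; rewrite invr_ge0 ltW.
apply: (scalerI (lt0r_neq0 k0)); rewrite scalerA mulfV ?gt_eqF // scale1r -/y.
apply: dotP => /=; last by move: e1 e2 hu hy; rewrite /y /=; lra.
by apply/eqP; rewrite -addr_eq0 addrC z.
Qed.

Theorem theorem2p17 (R : realType) (V : normedModType R)
    (hV : strictly_convex V) :
  absolute_order_unit_space (dot_cone V) (dot_abs V)
    (order_unit_norm (dot_cone V) (dot_unit V)) (dot_unit V) /\
  (forall (v : V) (a : R),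
    order_unit_norm (dot_cone V) (dot_unit V) (v, a) = `|v| + `|a|).
Proof.
have -> : order_unit_norm (dot_cone V) (dot_unit V) = dot_norm.
  by apply/funext => x; exact: dot_order_unit_normE.
split=> //; split; last first.
- by move=> x; rewrite dot_order_unit_normE.
- split; first by rewrite /dot_cone /= normr0.
  move=> x; exists (dot_norm x + 1); last by apply/dot_unit_intervalP; lra.
  by have := vnorm_ge0 dot_vector_norm x; lra.
split.
- exact: dot_absolutely_ordered.
- exact: dot_vector_norm.
- exact: dot_norm_interval.
- (* Orthogonality passes to smaller positive vectors, one side at a time. *)
  move=> u v Cu Cv huv u1 v1 u10 u1u v10 v1v; apply: dot_orth_infty.
  apply: (dot_orth_le hV _ v10 v1v); apply: dot_orth_sym.
  exact: (dot_orth_le hV (dot_orth_sym huv) u10 u1u).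
- move=> u v Cu Cv huv; apply: dot_infty_orth => //.
  apply: huv; rewrite /cone_le ?subr0 // subrr;
  exact: (cone0 (dot_cone_ordered V)).
Qed.
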